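(* Let $A_i\in\mathbb R^{n\times n}$, $D_i\in\mathbb R^{m\times n}$ ($i\in[\ell]$), $C\in\mathbb R^{p\times n}$. Let $\zeta,T>0$, symmetric $X_i\succ0$ in $\mathbb R^{n\times n}$ ($i\in[\ell]$) and $\Pi\in\mathcal M_\ell$ satisfy the Lyapunov-Metzler inequalities $$A_i^\top X_i+X_iA_i+\sum_{j\in[\ell]\setminus\{i\}}\Pi_{ij}(Y_{1,j}+Y_{2,j}-X_i)+C^\top C+2\zeta X_i\prec0,\quad i\in[\ell],$$ and let $P_i:[0,T]\to\mathbb R^{n\times n}$ be as in the context. Given $h>0$, $\alpha>0$, suppose there exist symmetric matrices $Q\succ0$, $W\succ0$, $R\succ0$ in $\mathbb R^{n\times n}$, matrices $Y_i\in\mathbb R^{n\times m}$ ($i\in[\ell]$) and $J\in\mathbb R^{n\times2n}$ such that $$\begin{bmatrix}R&0\\0&-W\end{bmatrix}+\begin{bmatrix}I_n\\-W\end{bmatrix}J+J^\top\begin{bmatrix}I_n&-W\end{bmatrix}\prec0$$ and $\Lambda_i(t)\prec0$ for all $i\in[\ell]$, $t\in[0,T]$, where $$\Lambda_i(t)=\begin{bmatrix} -2(\zeta-\alpha)P_i(t)&0&0&0&P_i(t)&0\\ \star&A_i^\top Q+QA_i-D_i^\top Y_i^\top-Y_iD_i+2\alpha Q&Y_iD_i&A_i^\top&D_i^\top Y_i^\top&-D_i^\top Y_i^\top\\ \star&\star&-\frac{\pi^2}{4}W&0&-D_i^\top Y_i^\top&D_i^\top Y_i^\top\\ \star&\star&\star&-h^{-2}\mathrm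 e^{-2\alpha h}R&0&I_n\\ \star&\star&\star&\star&-2Q&0\\ \star&\star&\star&\star&\star&-2Q\end{bmatrix}.$$ Then, with $L_i:=Q^{-1}Y_i$ and $U_i:=A_i-L_iD_i$, for all $i\in[\ell]$ and $t\in[0,T]$ and with the same $\zeta,\alpha,h,W,Q$, $$\begin{bmatrix}-2(\zeta-\alpha)P_i(t)&P_i(t)L_iD_i&-P_i(t)L_iD_i\\ \star&U_i^\top Q+QU_i+2\alpha Q+cU_i^\top WU_i&QL_iD_i+cU_i^\top WL_iD_i\\ \star&\star&-\frac{\pi^2}{4}W+cD_i^\top L_i^\top WL_iD_i\end{bmatrix}\prec0,\qquad c:=h^2\mathrm e^{2\alpha h}.$$
   Context: Notation: $[\ell]=\{1,\dots,\ell\}$; $\prec,\succ$ denote definiteness of symmetric matrices; $\star$ denotes entries determined by symmetry. $\mathcal M_\ell$ is the class of irreducible matrices $\Pi\in\mathbb R^{\ell\times\ell}$ with $\Pi_{ij}\ge0$ for $i\ne j$ and $\sum_j\Pi_{ij}=0$ for all $i$. $Y_{1,j}=\mathrm e^{(A_j^\top+\zeta I)T}X_j\mathrm e^{(A_j+\zeta I)T}$, $Y_{2,j}=\int_0^T\mathrm e^{(A_j^\top+\zeta I)\tau}C^\top C\,\mathrm e^{(A_j+\zeta I)\tau}d\tau$ (not to be confused with the decision variables $Y_i$). $P_i:[0,T]\to\mathbb R^{n\times n}$ is the (symmetric positive definite) solution of $-\dot P_i(t)=A_i^\top P_i(t)+P_i(t)A_i+C^\top C+2\zeta P_i(t)$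 on $[0,T)$ with $P_i(T)=X_i$. The last displayed matrix is the stability LMI matrix of the associated observer-based switching design in the case without nonlinearities. *)

(* Defs.v *)
From HB Require Import structures.
From mathcomp Require Import all_boot all_order all_algebra.
From mathcomp Require Import all_classical all_reals all_analysis.
Import Order.TTheory GRing.Theory Num.Theory.
Import numFieldNormedType.Exports.

Set Implicit Arguments.
Unset Strict Implicit.
Unset Printing Implicit Defensive.

Local Open Scope classical_set_scope.
Local Open Scope ring_scope.

Definition posdefmx (K : realType) n (M : 'M[K]_n) : Prop :=
  M^T = M /\ forall v : 'cV[K]_n, v != 0 -> 0 < (v^T *m M *m v) 0 0.

Definition negdefmx (K : realType) n (M : 'M[K]_n) : Prop :=
  M^T = M /\ forall v : 'cV[K]_n, v != 0 -> (v^T *m M *m v) 0 0 < 0.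

(* No simultaneous permutation of rows and columns makes M block triangular;
   with this convention every 1 x 1 matrix is irreducible. *)
Definition irreducible_mx (K : realType) l (M : 'M[K]_l) : Prop :=
  forall S : {set 'I_l}, S != finset.set0 -> S != finset.setT ->
    exists i j, [/\ i \in S, j \notin S & M i j != 0].

Definition metzler_class (K : realType) l (M : 'M[K]_l) : Prop :=
  [/\ irreducible_mx M,
      forall i j, i != j -> 0 <= M i j
    & forall i, \sum_j M i j = 0].

Definition expmx (K : realType) n (M : 'M[K]_n) : 'M[K]_n :=
  limn (series (fun k => (k`!%:R)^-1 *: M ^+ k)).

Definition Y1mx (K : realType) n (zeta T : K) (A X : 'M[K]_n) : 'M[K]_n :=
  expmx (T *: (A^T + zeta%:M)) *m X *m expmx (T *: (A + zeta%:M)).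

Definition Y2mx (K : realType) n p (zeta T : K) (A : 'M[K]_n)
    (C : 'M[K]_(p, n)) : 'M[K]_n :=
  \matrix_(a, b) \int[lebesgue_measure]_(tau in `[0, T])
    (expmx (tau *: (A^T + zeta%:M)) *m C^T *m C
       *m expmx (tau *: (A + zeta%:M))) a b.

Definition lyapunov_metzler (K : realType) l n p (zeta T : K)
    (A : 'I_l -> 'M[K]_n) (C : 'M[K]_(p, n)) (X : 'I_l -> 'M[K]_n)
    (Pi : 'M[K]_l) : Prop :=
  forall i, negdefmx
    ((A i)^T *m X i + X i *m A i
     + \sum_(j | j != i)
         Pi i j *: (Y1mx zeta T (A j) (X j) + Y2mx zeta T (A j) C - X i)
     + C^T *m C + (2 * zeta) *: X i).

(* The limit is taken within [0, T], so that it is the one-sided derivative at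
   the endpoints. *)
Definition derivative_within (K : realType) n (T : K) (P : K -> 'M[K]_n)
    (t : K) (dP : 'M[K]_n) : Prop :=
  (s - t)^-1 *: (P s - P t) @[s --> within `[0, T] t^'] --> dP.

(* P is a function on the whole line whose values outside [0, T] are
   irrelevant. *)
Definition lyapunov_solution (K : realType) n p (zeta T : K) (A : 'M[K]_n)
    (C : 'M[K]_(p, n)) (X : 'M[K]_n) (P : K -> 'M[K]_n) : Prop :=
  [/\ {within `[0, T], continuous P},
      forall t, 0 <= t < T ->
        derivative_within T P t
          (- (A^T *m P t + P t *m A + C^T *m C + (2 * zeta) *: P t)),
      P T = X
    & forall t, 0 <= t <= T -> posdefmx (P t)].

(* [M11 M12; * M22] *)
Definition sym_block (K : realType) n1 n2 (M11 : 'M[K]_n1)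
    (M12 : 'M[K]_(n1, n2)) (M22 : 'M[K]_n2) : 'M[K]_(n1 + n2) :=
  block_mx M11 M12 M12^T M22.

Definition aux_lmi (K : realType) n (R W : 'M[K]_n) (J : 'M[K]_(n, n + n)) :
    'M[K]_(n + n) :=
  block_mx R 0 0 (- W) + col_mx 1%:M (- W) *m J + J^T *m row_mx 1%:M (- W).

Definition design_lmi (K : realType) n m (zeta alpha h : K) (A : 'M[K]_n)
    (D : 'M[K]_(m, n)) (Q W R : 'M[K]_n) (Y : 'M[K]_(n, m)) (P : 'M[K]_n) :
    'M[K]_(n + (n + (n + (n + (n + n))))) :=
  sym_block (- (2 * (zeta - alpha)) *: P)
    (row_mx 0 (row_mx 0 (row_mx 0 (row_mx P 0))))
  (sym_block (A^T *m Q + Q *m A - D^T *m Y^T - Y *m D + (2 * alpha) *: Q)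
    (row_mx (Y *m D) (row_mx A^T (row_mx (D^T *m Y^T) (- (D^T *m Y^T)))))
  (sym_block (- (pi ^+ 2 / 4) *: W)
    (row_mx 0 (row_mx (- (D^T *m Y^T)) (D^T *m Y^T)))
  (sym_block (- (h ^- 2 * expR (- (2 * alpha * h))) *: R)
    (row_mx 0 1%:M)
  (sym_block (- 2 *: Q)
    0
  (- 2 *: Q))))).

Definition stability_lmi (K : realType) n m (zeta alpha h : K) (A : 'M[K]_n)
    (D : 'M[K]_(m, n)) (Q W : 'M[K]_n) (L : 'M[K]_(n, m)) (P : 'M[K]_n) :
    'M[K]_(n + (n + n)) :=
  let U := A - L *m D in
  let c := h ^+ 2 * expR (2 * alpha * h) in
  sym_block (- (2 * (zeta - alpha)) *: P)
    (row_mx (P *m L *m D) (- (P *m L *m D)))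
  (sym_block (U^T *m Q + Q *m U + (2 * alpha) *: Q + c *: (U^T *m W *m U))
    (Q *m L *m D + c *: (U^T *m W *m L *m D))
  (- (pi ^+ 2 / 4) *: W + c *: (D^T *m L^T *m W *m L *m D))).

(* Main.v *)
Require Import Defs.
From HB Require Import structures.
From mathcomp Require Import all_boot all_order all_algebra.
From mathcomp Require Import all_classical all_reals all_analysis.
From mathcomp Require Import lra.
Import Order.TTheory GRing.Theory Num.Theory.
Import numFieldNormedType.Exports.
Local Open Scope ring_scope.

(** With L := Q^-1 Y, put x := LD(b - d) and y := Ub + LDd.
    The quadratic form of the stability LMI at (a, b, d) is bounded above by
    that of the design LMI at (a, b, d, cWy, x, -x): the entries x and -x
    cancel the Q-terms they create, and 2 e^T y - c^-1 e^T R e at e = cWy equals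
    2c y^T W y - c y^T WRW y >= c y^T W y, since the auxiliary LMI
    tested on the vectors (Wz, z), which [I -W] annihilates, says WRW < W. *)

(** Quadratic forms are expanded into scalars [dotmx u (M *m v)], so that comparing two block
    matrices becomes linear arithmetic in [K]. *)
Definition dotmx {K : realType} {n : nat} (u v : 'cV[K]_n) : K := (u^T *m v) 0 0.

Lemma dotmxC {K : realType} {n : nat} (u v : 'cV[K]_n) : dotmx u v = dotmx v u.
Proof. by rewrite /dotmx -[v^T *m u]trmxK trmx_mul trmxK [RHS]mxE. Qed.

Lemma dotmxDr {K : realType} {n : nat} (u v w : 'cV[K]_n) :
  dotmx u (v + w) = dotmx u v + dotmx u w.
Proof. by rewrite /dotmx mulmxDr mxE. Qed.

Lemma dotmxZr {K : realType} {n : nat} (c : K) (u v : 'cV[K]_n) :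
  dotmx u (c *: v) = c * dotmx u v.
Proof. by rewrite /dotmx -scalemxAr mxE. Qed.

Lemma dotmxNr {K : realType} {n : nat} (u v : 'cV[K]_n) :
  dotmx u (- v) = - dotmx u v.
Proof. by rewrite -scaleN1r dotmxZr mulN1r. Qed.

Lemma dotmx0r {K : realType} {n : nat} (u : 'cV[K]_n) : dotmx u 0 = 0.
Proof. by rewrite /dotmx mulmx0 mxE. Qed.

Lemma dotmxDl {K : realType} {n : nat} (u v w : 'cV[K]_n) :
  dotmx (u + v) w = dotmx u w + dotmx v w.
Proof. by rewrite dotmxC dotmxDr !(dotmxC w). Qed.

Lemma dotmxZl {K : realType} {n : nat} (c : K) (u v : 'cV[K]_n) :
  dotmx (c *: u) v = c * dotmx u v.
Proof. by rewrite dotmxC dotmxZr dotmxC. Qed.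

Lemma dotmxNl {K : realType} {n : nat} (u v : 'cV[K]_n) :
  dotmx (- u) v = - dotmx u v.
Proof. by rewrite dotmxC dotmxNr dotmxC. Qed.

Lemma dotmx_tr {K : realType} {m n : nat} (M : 'M[K]_(m, n))
    (u : 'cV[K]_n) (v : 'cV[K]_m) :
  dotmx u (M^T *m v) = dotmx (M *m u) v.
Proof. by rewrite /dotmx trmx_mul mulmxA. Qed.

Lemma dotmx_sym {K : realType} {n : nat} (M : 'M[K]_n) (u v : 'cV[K]_n) :
  M^T = M -> dotmx u (M *m v) = dotmx v (M *m u).
Proof. by move=> M_sym; rewrite -{1}M_sym dotmx_tr dotmxC. Qed.

Lemma dotmx_col {K : realType} {m n : nat} (u1 v1 : 'cV[K]_m)
    (u2 v2 : 'cV[K]_n) :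
  dotmx (col_mx u1 u2) (col_mx v1 v2) = dotmx u1 v1 + dotmx u2 v2.
Proof. by rewrite /dotmx tr_col_mx mul_row_col mxE. Qed.

(** Transposition makes the two off-diagonal contributions equal. Repeated rewriting peels the
    nested blocks one level at a time. *)
Lemma dotmx_sym_block {K : realType} {m n : nat} (M11 : 'M[K]_m)
    (M12 : 'M[K]_(m, n)) (M22 : 'M[K]_n) (u : 'cV[K]_m) (v : 'cV[K]_n) :
  dotmx (col_mx u v) (sym_block M11 M12 M22 *m col_mx u v) =
    dotmx u (M11 *m u) + 2 * dotmx u (M12 *m v) + dotmx v (M22 *m v).
Proof.
rewrite /sym_block mul_block_col dotmx_col !dotmxDr dotmx_tr.
by rewrite (dotmxC (M12 *m v)) mulr2n mulrDl mul1r !addrA.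
Qed.

Lemma tr_sym_block {K : realType} {m n : nat} (M11 : 'M[K]_m)
    (M12 : 'M[K]_(m, n)) (M22 : 'M[K]_n) :
  M11^T = M11 -> M22^T = M22 ->
  (sym_block M11 M12 M22)^T = sym_block M11 M12 M22.
Proof. by move=> s1 s2; rewrite /sym_block tr_block_mx s1 s2 trmxK. Qed.

Lemma negdefmx_dotmx_lt0 {K : realType} {n : nat} (M : 'M[K]_n) (v : 'cV[K]_n) :
  negdefmx M -> v != 0 -> dotmx v (M *m v) < 0.
Proof. by move=> [_ Mneg] v0; rewrite /dotmx mulmxA; exact: Mneg. Qed.

Lemma posdefmx_unit {K : realType} {n : nat} (M : 'M[K]_n) :
  posdefmx M -> M \in unitmx.
Proof.
move=> [M_sym M_pos]; rewrite -row_free_unit -kermx_eq0.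
apply/rowV0P => u /sub_kermxP uM0; apply/eqP/negPn/negP => u0.
have /M_pos : u^T != 0 by rewrite trmx_eq0.
by rewrite trmxK uM0 mul0mx mxE ltxx.
Qed.

Lemma aux_lmi_le {K : realType} {n : nat} (R W : 'M[K]_n) (J : 'M[K]_(n, n + n))
    (z : 'cV[K]_n) :
  W^T = W -> negdefmx (aux_lmi R W J) ->
  dotmx (W *m z) (R *m (W *m z)) <= dotmx z (W *m z).
Proof.
move=> W_sym aux_neg; have [->|z0] := eqVneq z 0.
  by rewrite !mulmx0 !dotmx0r.
have ker : row_mx 1%:M (- W) *m col_mx (W *m z) z = 0.
  by rewrite mul_row_col mul1mx mulNmx subrr.
have v0 : col_mx (W *m z) z != 0 by rewrite col_mx_eq0 negb_and z0 orbT.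
have := negdefmx_dotmx_lt0 _ _ aux_neg v0.
rewrite /aux_lmi.
(* Symmetry of [W] makes the left factor the transpose of the row in [ker], so both [J] terms vanish
   at the test vector, whatever [J] is. *)
have -> : col_mx 1%:M (- W) = (row_mx 1%:M (- W))^T.
  by rewrite tr_row_mx trmx1 linearN /= W_sym.
rewrite !mulmxDl !dotmxDr -!mulmxA ker mulmx0 dotmx0r dotmx_tr ker.
rewrite [dotmx 0 _]dotmxC dotmx0r !addr0 mul_block_col !mul0mx addr0 add0r.
by rewrite dotmx_col mulNmx dotmxNr subr_lt0 => /ltW.
Qed.

(** [c], [x] and [y] are variables tied by equations, so that they stay opaque while the blocks are
    multiplied out. A weak inequality suffices, since the design form is strictly negative at any
    nonzero [w]. *)
Lemma stability_design_le {K : realType} {n m : nat} (zeta alpha h c : K)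
    (A : 'M[K]_n) (D : 'M[K]_(m, n)) (Q W R P : 'M[K]_n) (L : 'M[K]_(n, m))
    (J : 'M[K]_(n, n + n)) (a b d x y : 'cV[K]_n) :
  h != 0 -> Q^T = Q -> W^T = W -> negdefmx (aux_lmi R W J) ->
  c = h ^+ 2 * expR (2 * alpha * h) ->
  x = L *m (D *m (b - d)) ->
  y = (A - L *m D) *m b + L *m (D *m d) ->
  let v := col_mx a (col_mx b d) in
  let w := col_mx a (col_mx b (col_mx d
             (col_mx (c *: (W *m y)) (col_mx x (- x))))) in
  is_true (dotmx v (stability_lmi zeta alpha h A D Q W L P *m v) <=
           dotmx w (design_lmi zeta alpha h A D Q W R (Q *m L) P *m w)).
Proof.
move=> h0 Q_sym W_sym aux_neg cE xE yE v w.
have c_gt0 : 0 < c by rewrite cE mulr_gt0 ?expR_gt0 ?exprn_even_gt0//=.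
have cV : h ^- 2 * expR (- (2 * alpha * h)) = c^-1.
  by rewrite cE expRN -invfM.
have WRW : c * dotmx (W *m y) (R *m (W *m y)) <= c * dotmx y (W *m y).
  by rewrite ler_pM2l//; exact: aux_lmi_le aux_neg.
have c0 : c != 0 by rewrite gt_eqF.
rewrite /v /w /stability_lmi /design_lmi cV -cE !dotmx_sym_block.
rewrite !mul_row_col !mul0mx ?mul1mx ?addr0 ?add0r.
set r := dotmx (W *m y) (R *m (W *m y)) in WRW *.
have rE : dotmx (c *: (W *m y)) ((- c^-1 *: R) *m (c *: (W *m y))) = - (c * r).
  rewrite -scalemxAl -scalemxAr !dotmxZr dotmxZl mulNr -/r.
  by rewrite mulKf.
(* [R] now enters only through [r], which becomes an arbitrary number bounded by [WRW]. *)
rewrite {}rE; move: r WRW => r WRW.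
(* Normal form for the scalars: [Q] and [W] are moved into the second argument. *)
have QC u1 u2 := dotmx_sym Q u1 u2 Q_sym.
have WC u1 u2 := dotmx_sym W u1 u2 W_sym.
have Ql u1 u2 : dotmx (Q *m u1) u2 = dotmx u1 (Q *m u2) by rewrite dotmxC QC.
have Wl u1 u2 : dotmx (W *m u1) u2 = dotmx u1 (W *m u2) by rewrite dotmxC WC.
rewrite {}xE {}yE in WRW *.
do 2 rewrite ?(mulmxDl, mulmxDr, mulNmx, mulmxN) -?scalemxAl -?mulmxA.
do 2 rewrite ?(mulmxDl, mulmxDr, mulNmx, mulmxN) -?scalemxAr -?mulmxA
  ?(dotmxDr, dotmxDl, dotmxNr, dotmxNl, dotmxZr, dotmxZl, dotmx0r, dotmx_tr).
rewrite ?(mulmxDl, mulmxDr, mulNmx, mulmxN, dotmxDr, dotmxDl, dotmxNr, dotmxNl) in WRW.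
rewrite -?mulmxA in WRW *.
rewrite ?(Ql, Wl) in WRW *.
(* Mixed terms that occur in both orders get a single orientation, so that [lra] sees equal terms as
   the same atom. *)
rewrite (QC (A *m b) b) (QC (L *m (D *m b)) b)
  (QC (L *m (D *m d)) (L *m (D *m b))).
rewrite (WC (L *m (D *m b)) (A *m b)) (WC (L *m (D *m d)) (A *m b))
  (WC (L *m (D *m d)) (L *m (D *m b))) in WRW *.
(* The design form minus the stability form equals [c * dotmx y (W *m y) - c * r] in expanded form,
   which [WRW] makes nonnegative. *)
lra.
Qed.

Theorem proposition1 (K : realType) (l n m p : nat)
    (A : 'I_l -> 'M[K]_n) (D : 'I_l -> 'M[K]_(m, n)) (C : 'M[K]_(p, n))
    (zeta T : K) (X : 'I_l -> 'M[K]_n) (Pi : 'M[K]_l)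
    (P : 'I_l -> K -> 'M[K]_n) (h alpha : K)
    (Q W R : 'M[K]_n) (Y : 'I_l -> 'M[K]_(n, m)) (J : 'M[K]_(n, n + n)) :
  0 < zeta -> 0 < T ->
  (forall i, posdefmx (X i)) ->
  metzler_class Pi ->
  lyapunov_metzler zeta T A C X Pi ->
  (forall i, lyapunov_solution zeta T (A i) C (X i) (P i)) ->
  0 < h -> 0 < alpha ->
  posdefmx Q -> posdefmx W -> posdefmx R ->
  negdefmx (aux_lmi R W J) ->
  (forall i t, 0 <= t <= T ->
    negdefmx (design_lmi zeta alpha h (A i) (D i) Q W R (Y i) (P i t))) ->
  forall i t, 0 <= t <= T ->
    negdefmx (stability_lmi zeta alpha h (A i) (D i) Q W
                (invmx Q *m Y i) (P i t)).
Proof.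
move=> _ _ _ _ _ Psol h_gt0 _ Qpos Wpos _ aux_neg design i t tT.
have [Q_sym _] := Qpos; have [W_sym _] := Wpos.
have [_ _ _ /(_ t tT)[P_sym _]] := Psol i.
set L := invmx Q *m Y i.
have YE : Y i = Q *m L by rewrite mulKVmx// posdefmx_unit.
have {design} := design i t tT; rewrite YE => design.
split=> [|v v_neq0].
  apply: tr_sym_block; first by rewrite linearZ /= P_sym.
  apply: tr_sym_block.
    (* Transposition exchanges [U^T *m Q] and [Q *m U], whence the commutation of the first sum. *)
    set U := A i - _; rewrite 3!linearD !linearZ /= !trmx_mul !trmxK Q_sym W_sym.
    by rewrite mulmxA [X in X + _ + _]addrC.
  by rewrite linearD !linearZ /= !trmx_mul !trmxK W_sym !mulmxA.
rewrite -[v]vsubmxK -[dsubmx v]vsubmxK in v_neq0 *.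
rewrite -mulmxA -/(dotmx _ _).
(* The three [erefl] supply the values of [c], [x] and [y]. *)
have le := stability_design_le zeta alpha h _ (A i) (D i) Q W R (P i t) L J
  (usubmx v) (usubmx (dsubmx v)) (dsubmx (dsubmx v)) _ _
  (lt0r_neq0 h_gt0) Q_sym W_sym aux_neg erefl erefl erefl.
apply: (le_lt_trans le).
apply: negdefmx_dotmx_lt0 => //.
(* The three blocks of [v] are also blocks of the extended vector, which is therefore nonzero. *)
move: v_neq0; rewrite !col_mx_eq0 !negb_and.
by case/or3P => ->; rewrite ?orbT.
Qed.
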